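(* Let $A$ and $B$ be self-adjoint operators on a separable Hilbert space $\mathcal{H}$, with $B$ bounded and nonnegative. Then for every $\phi\in\mathcal{H}$, $$\sum_{n\in\mathbb{Z}}\ \sup_{y\in[0,1]}\ \Big\langle B\phi,\ \frac{1}{(A+(n+y)B)^2+1}\,B\phi\Big\rangle \le \pi\|B\|(1+\|B\|)\|\phi\|^2.$$ *)

(* Defs.v *)
From HB Require Import structures.
From mathcomp Require Import all_boot all_order all_algebra.
From mathcomp Require Import complex.
From mathcomp Require Import all_classical all_reals all_analysis.
Set Implicit Arguments. Unset Strict Implicit. Unset Printing Implicit Defensive.
Import Order.TTheory GRing.Theory Num.Theory.
Local Open Scope ring_scope.
Local Open Scope classical_set_scope.

Section HilbertDefs.
Variable R : realType.
Local Notation C := (R[i]).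
Variable H : lmodType C.
(* ip x y = <x, y>, conjugate-linear in x, linear in y *)
Variable ip : H -> H -> C.

Definition ipnorm (x : H) : R := Num.sqrt (complex.Re (ip x x)).

Definition inner_product_axioms : Prop :=
  [/\ (forall x y z : H, forall a : C, ip x (a *: y + z) = a * ip x y + ip x z),
      (forall x y : H, ip y x = conjc (ip x y)),
      (forall x : H, 0 <= complex.Re (ip x x)) &
      (forall x : H, ip x x = 0 -> x = 0)].

Definition complete_ip : Prop :=
  forall u : nat -> H,
    (forall e : R, 0 < e -> exists N : nat, forall m n : nat,
        (N <= m)%N -> (N <= n)%N -> ipnorm (u m - u n) < e) ->
    exists l : H, forall e : R, 0 < e -> exists N : nat, forall n : nat,
        (N <= n)%N -> ipnorm (u n - l) < e.

Definition dense_set (S : set H) : Prop :=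
  forall (x : H) (e : R), 0 < e -> exists2 u, S u & ipnorm (x - u) < e.

Definition separable_ip : Prop :=
  exists2 S : set H, countable S & dense_set S.

Definition separable_hilbert_space : Prop :=
  [/\ inner_product_axioms, complete_ip & separable_ip].

Definition linear_on (D : set H) (A : H -> H) : Prop :=
  [/\ D 0,
      (forall x y, D x -> D y -> D (x + y) /\ A (x + y) = A x + A y) &
      (forall (a : C) x, D x -> D (a *: x) /\ A (a *: x) = a *: A x)].

(* (possibly unbounded) self-adjoint operator with domain D:
   densely defined, symmetric, and dom(A^* ) is contained in D *)
Definition selfadjoint (D : set H) (A : H -> H) : Prop :=
  [/\ linear_on D A, dense_set D,
      (forall u v, D u -> D v -> ip (A u) v = ip u (A v)) &
      (forall v z : H, (forall u, D u -> ip (A u) v = ip u z) -> D v)].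

Definition bounded_op (B : H -> H) : Prop :=
  exists M : R, forall x, ipnorm (B x) <= M * ipnorm x.

Definition bounded_nonneg (B : H -> H) : Prop :=
  [/\ linear_on setT B, bounded_op B,
      (forall x y, ip (B x) y = ip x (B y)) &
      (forall x, 0 <= complex.Re (ip x (B x)))].

Definition opnorm (B : H -> H) : R :=
  sup [set ipnorm (B x) | x in [set x | ipnorm x <= 1]].

(* ((T)^2 + 1)^{-1} psi for an operator T with domain D: the (unique, when T
   is self-adjoint) w in dom(T^2) = {w in D | T w in D} with T(T w) + w = psi *)
Definition sq1inv (D : set H) (T : H -> H) (psi : H) : H :=
  xget 0 [set w | D w /\ D (T w) /\ T (T w) + w = psi].

End HilbertDefs.

(* Main.v *)
Require Import Defs.
From HB Require Import structures.
From mathcomp Require Import all_boot all_order all_algebra.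
From mathcomp Require Import complex.
From mathcomp Require Import all_classical all_reals all_analysis.
From mathcomp Require Import finmap zify ring lra.
Import Order.TTheory GRing.Theory Num.Theory.
Import numFieldNormedType.Exports.
Local Open Scope ring_scope.
Local Open Scope classical_set_scope.

(* Write psi = B phi and, for Im z <= 0, let w_z be the solution of (A + zB - i) w_z = psi.  For real s the summand is |w_s|^2, and the resolvent identity gives the Harnack inequality |w_s| <= (1 + |B| |s - z|) |w_z|, so that any Q with Q'(t) >= |w_s|^2 / (1 + |B| |s - t|)^2 satisfies |w_s|^2 <= (1 + |B|) (Q(n+1) - Q(n)) for s in [n, n+1], because the integral of (1 + |B| |s - t|)^-2 over [n, n+1] is at least 1 / (1 + |B|).  The sum then telescopes, and it remains to find such a Q with total increase close to pi <phi, B phi>.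

The function u(z) = Im <phi, B w_z> dominates |w_z|^2 and is harmonic in the lower half plane.  Under the Cayley transform z = -iY (1 - zeta) / (1 + zeta), with centre -iY, it is the imaginary part of a power series in zeta: with X = (A - iYB - i)^-1 B and V = 1 + 2iYX, a contraction for the seminorm <x, Bx>^(1/2), one has w = (1 + zeta) X phi - zeta V w.  Hence on a circle |zeta| = r < 1 a primitive of a truncation of this series increases by 2 pi u(-iY) up to a small error, and u(-iY) <= <phi, B phi> / Y.  Reading this primitive at the angle 2 atan (s / Y) gives Q, after r -> 1 and Y -> infinity. *)

Set Implicit Arguments.
Unset Strict Implicit.
Unset Printing Implicit Defensive.

(** * Hermitian forms and the norm *)

Section ComplexParts.
Variable R : realType.
Implicit Types x y : R[i].

Lemma cReD x y : complex.Re (x + y) = complex.Re x + complex.Re y.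
Proof. by case: x; case: y. Qed.

Lemma cImD x y : complex.Im (x + y) = complex.Im x + complex.Im y.
Proof. by case: x; case: y. Qed.

Lemma cReN x : complex.Re (- x) = - complex.Re x.
Proof. by case: x. Qed.

Lemma cImN x : complex.Im (- x) = - complex.Im x.
Proof. by case: x. Qed.

Lemma cReM x y :
  complex.Re (x * y) = complex.Re x * complex.Re y - complex.Im x * complex.Im y.
Proof. by case: x; case: y. Qed.

Lemma cImM x y :
  complex.Im (x * y) = complex.Re x * complex.Im y + complex.Im x * complex.Re y.
Proof. by case: x; case: y. Qed.

Lemma cReJ x : complex.Re (conjc x) = complex.Re x.
Proof. by case: x. Qed.

Lemma cImJ x : complex.Im (conjc x) = - complex.Im x.
Proof. by case: x. Qed.

Lemma complex_eq x y :
  complex.Re x = complex.Re y -> complex.Im x = complex.Im y -> x = y.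
Proof. by case: x; case: y => /= ? ? ? ? -> ->. Qed.

End ComplexParts.

Section HermitianForms.
Variables (R : realType) (H : lmodType R[i]).
Implicit Types (h : H -> H -> R[i]) (x y z : H) (a : R[i]).

(** Semidefinite only, so that the possibly degenerate form <x, By> is an instance next to [ip]. *)
Definition hermitian_nonneg h :=
  [/\ (forall x y z a, h x (a *: y + z) = a * h x y + h x z),
      (forall x y, h y x = conjc (h x y)) &
      (forall x, 0 <= complex.Re (h x x))].

Definition reform h x y := complex.Re (h x y).
Definition imform h x y := complex.Im (h x y).

Variable h : H -> H -> R[i].
Hypothesis hh : hermitian_nonneg h.
Notation re := (reform h).
Notation im := (imform h).

Let hDr x y z : h x (y + z) = h x y + h x z.
Proof. by case: hh => l _ _; rewrite -[y]scale1r l mul1r scale1r. Qed.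

Let h0r x : h x 0 = 0.
Proof. by apply: (addIr (h x 0)); rewrite -hDr !add0r. Qed.

Let hZr x y a : h x (a *: y) = a * h x y.
Proof. by case: hh => l _ _; rewrite -[a *: y]addr0 l h0r addr0. Qed.

Lemma reC x y : re y x = re x y.
Proof. by case: hh => _ c _; rewrite /reform c cReJ. Qed.

Lemma imC x y : im y x = - im x y.
Proof. by case: hh => _ c _; rewrite /imform c cImJ. Qed.

Lemma re_ge0 x : 0 <= re x x.
Proof. by case: hh => _ _ p; exact: p. Qed.

Lemma im_diag x : im x x = 0.
Proof. have := imC x x; lra. Qed.

Lemma reDr x y z : re x (y + z) = re x y + re x z.
Proof. by rewrite /reform hDr cReD. Qed.

Lemma imDr x y z : im x (y + z) = im x y + im x z.
Proof. by rewrite /imform hDr cImD. Qed.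

Lemma reDl x y z : re (y + z) x = re y x + re z x.
Proof. by rewrite reC reDr !(reC x). Qed.

Lemma imDl x y z : im (y + z) x = im y x + im z x.
Proof. by rewrite imC imDr opprD -!imC. Qed.

Lemma reZr x y a : re x (a *: y) = complex.Re a * re x y - complex.Im a * im x y.
Proof. by rewrite /reform hZr cReM. Qed.

Lemma imZr x y a : im x (a *: y) = complex.Re a * im x y + complex.Im a * re x y.
Proof. by rewrite /imform hZr cImM. Qed.

Lemma reZl x y a : re (a *: y) x = complex.Re a * re y x + complex.Im a * im y x.
Proof. by rewrite reC reZr (reC x y) (imC x y); ring. Qed.

Lemma imZl x y a : im (a *: y) x = complex.Re a * im y x - complex.Im a * re y x.
Proof. by rewrite imC imZr (reC x y) (imC x y); ring. Qed.

Lemma reNr x y : re x (- y) = - re x y.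
Proof. by rewrite -scaleN1r reZr /=; ring. Qed.

Lemma imNr x y : im x (- y) = - im x y.
Proof. by rewrite -scaleN1r imZr /=; ring. Qed.

Lemma reNl x y : re (- y) x = - re y x.
Proof. by rewrite reC reNr (reC x). Qed.

Lemma imNl x y : im (- y) x = - im y x.
Proof. by rewrite imC imNr (imC x); ring. Qed.

Definition formE := (reDr, reDl, imDr, imDl, reNr, reNl, imNr, imNl,
  reZr, reZl, imZr, imZl).

Lemma re_sqrD x y : re (x + y) (x + y) = re x x + re y y + 2 * re x y.
Proof. by rewrite !formE (reC x y); ring. Qed.

Lemma re_sqrZ a x :
  re (a *: x) (a *: x) = (complex.Re a ^+ 2 + complex.Im a ^+ 2) * re x x.
Proof. by rewrite !formE im_diag; ring. Qed.

Lemma re_parallelogram x y :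
  re (x - y) (x - y) = 2 * re x x + 2 * re y y - re (x + y) (x + y).
Proof. by rewrite !formE (reC x y); ring. Qed.

Lemma re_cauchy_schwarz x y : re x y ^+ 2 <= re x x * re y y.
Proof.
have key (c : R) : 0 <= re x x + c ^+ 2 * re y y + 2 * c * re x y.
  have := re_ge0 (x + (c%:C)%C *: y).
  by rewrite re_sqrD re_sqrZ reZr /= expr0n /=; lra.
have x0 := re_ge0 x; have y0 := re_ge0 y.
have [yz|yn] := eqVneq (re y y) 0.
  suff -> : re x y = 0 by rewrite yz mulr0 expr0n.
  apply/eqP; apply: contraT => n0.
  (* With [re y y = 0] the expression in [key] is affine in [c], and this [c] would give it the
     value -1. *)
  have := key (- (re x x + 1) / (2 * re x y)).
  have -> : 2 * (- (re x x + 1) / (2 * re x y)) * re x y = - (re x x + 1).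
    by field.
  by rewrite yz mulr0; lra.
have := key (- re x y / re y y).
have -> : re x x + (- re x y / re y y) ^+ 2 * re y y
   + 2 * (- re x y / re y y) * re x y = (re x x * re y y - re x y ^+ 2) / re y y.
  by field.
by rewrite ler_pdivlMr ?mul0r ?subr_ge0 // lt_def yn.
Qed.

(** Multiplying [y] by the conjugate of [h x y] makes the pairing real and equal to [n]; the real
    inequality then reads n^2 <= n * (re x x * re y y). *)
Lemma form_cauchy_schwarz x y : re x y ^+ 2 + im x y ^+ 2 <= re x x * re y y.
Proof.
set n := re x y ^+ 2 + im x y ^+ 2.
have n0 : 0 <= n by rewrite addr_ge0 ?sqr_ge0.
have := re_cauchy_schwarz x (Complex (re x y) (- im x y) *: y).
rewrite re_sqrZ reZr /= sqrrN -/n.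
have -> : re x y * re x y - - im x y * im x y = n by rewrite /n; ring.
have [->|nn] := eqVneq n 0; first by rewrite mulr_ge0 ?re_ge0.
by rewrite mulrCA expr2 ler_pM2l // lt_def nn.
Qed.

End HermitianForms.

Section Norm.
Variables (R : realType) (H : lmodType R[i]) (ip : H -> H -> R[i]).
Hypothesis hip : inner_product_axioms ip.
Notation re := (reform ip).
Notation im := (imform ip).
Notation norm := (ipnorm ip).
Implicit Types (x y z : H) (u v : nat -> H).

Lemma ip_hermitian : hermitian_nonneg ip.
Proof. by case: hip => l c p _; split=> // x y z a; exact: l. Qed.
Let hh := ip_hermitian.

Lemma ipnorm_ge0 x : 0 <= norm x.
Proof. exact: sqrtr_ge0. Qed.

Lemma ipnorm_sqr x : norm x ^+ 2 = re x x.
Proof. by rewrite sqr_sqrtr // (re_ge0 hh). Qed.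

Lemma re_diag_eq0 x : re x x = 0 -> x = 0.
Proof.
case: hip => _ _ _ s rx; apply: s; apply: complex_eq; first exact: rx.
exact: im_diag hh x.
Qed.

Lemma ipnorm_eq0 x : norm x = 0 -> x = 0.
Proof. by move=> nx; apply: re_diag_eq0; rewrite -ipnorm_sqr nx expr0n. Qed.

Lemma ipnorm_le x (c : R) : 0 <= c -> re x x <= c ^+ 2 -> norm x <= c.
Proof. by move=> c0 h; rewrite -(ler_pXn2r (n := 2)) ?nnegrE ?ipnorm_ge0// ipnorm_sqr. Qed.

Lemma re_le_norm x y : `|re x y| <= norm x * norm y.
Proof.
rewrite -(ler_pXn2r (n := 2)) ?nnegrE ?mulr_ge0 ?ipnorm_ge0//.
by rewrite real_normK ?num_real// exprMn !ipnorm_sqr (re_cauchy_schwarz hh).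
Qed.

Lemma im_le_norm x y : `|im x y| <= norm x * norm y.
Proof.
rewrite -(ler_pXn2r (n := 2)) ?nnegrE ?mulr_ge0 ?ipnorm_ge0//.
rewrite real_normK ?num_real// exprMn !ipnorm_sqr.
by apply: le_trans (form_cauchy_schwarz hh x y); rewrite lerDr sqr_ge0.
Qed.

Lemma ipnormD x y : norm (x + y) <= norm x + norm y.
Proof.
apply: ipnorm_le; first by rewrite addr_ge0 ?ipnorm_ge0.
rewrite (re_sqrD hh) -!ipnorm_sqr.
by have := le_trans (ler_norm _) (re_le_norm x y); nra.
Qed.

Lemma ipnormZ (a : R[i]) x :
  norm (a *: x) = Num.sqrt (complex.Re a ^+ 2 + complex.Im a ^+ 2) * norm x.
Proof.
rewrite {1}/ipnorm -/(re _ _) (re_sqrZ hh) sqrtrM //.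
by rewrite addr_ge0 ?sqr_ge0.
Qed.

Lemma ipnormZr (c : R) x : norm ((c%:C)%C *: x) = `|c| * norm x.
Proof. by rewrite ipnormZ /= expr0n addr0 sqrtr_sqr. Qed.

Lemma ipnormN x : norm (- x) = norm x.
Proof. by rewrite -scaleN1r ipnormZ /= oppr0 expr0n addr0 sqrrN expr1n sqrtr1 mul1r. Qed.

Lemma ipnormB x y : norm (x - y) = norm (y - x).
Proof. by rewrite -ipnormN opprB. Qed.

Definition ip_cvg u x := forall e : R, 0 < e -> exists N : nat,
  forall n : nat, (N <= n)%N -> norm (u n - x) < e.

Lemma ip_cvg_lipschitz (f : H -> H) (c : R) u x :
  (forall y, norm (f y - f x) <= c * norm (y - x)) ->
  ip_cvg u x -> ip_cvg (f \o u) (f x).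
Proof.
move=> fc ux e e0.
have c0 : 0 < `|c| + 1 by rewrite ltr_wpDl.
have [N hN] := ux _ (divr_gt0 e0 c0); exists N => n Nn /=.
apply: le_lt_trans (fc _) _.
have := hN n Nn; rewrite ltr_pdivlMr// => h.
apply: le_lt_trans h; rewrite mulrC ler_wpM2l ?ipnorm_ge0//.
by apply: le_trans (ler_norm _) _; rewrite lerDl.
Qed.

Lemma ip_cvgD u v x y : ip_cvg u x -> ip_cvg v y -> ip_cvg (fun n => u n + v n) (x + y).
Proof.
move=> ux vy e e0; have e2 : 0 < e / 2 by rewrite divr_gt0.
have [N hN] := ux _ e2; have [N' hN'] := vy _ e2.
exists (maxn N N') => n; rewrite geq_max => /andP[h1 h2].
rewrite opprD addrACA; apply: le_lt_trans (ipnormD _ _) _.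
by have := hN n h1; have := hN' n h2; lra.
Qed.

Lemma ip_cvgZ (a : R[i]) u x : ip_cvg u x -> ip_cvg (fun n => a *: u n) (a *: x).
Proof.
by apply: ip_cvg_lipschitz => y; rewrite -scalerBr ipnormZ; exact: lexx.
Qed.

Lemma ip_cvg_form (x y : H) u v l k :
  (forall n, ip x (u n) = ip y (v n)) -> ip_cvg u l -> ip_cvg v k ->
  ip x l = ip y k.
Proof.
move=> uv ul vk.
have small (e : R) : 0 < e -> exists n, norm (u n - l) < e /\ norm (v n - k) < e.
  move=> e0; have [N hN] := ul _ e0; have [N' hN'] := vk _ e0.
  by exists (maxn N N'); rewrite hN ?leq_maxl// hN' ?leq_maxr.
have x0 := ipnorm_ge0 x; have y0 := ipnorm_ge0 y.
have arch (a : R) : (forall e, 0 < e -> a <= (norm x + norm y) * e) -> a <= 0.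
  move=> h; rewrite leNgt; apply/negP => a0.
  have n0 : 0 < norm x + norm y + 1 by rewrite ltr_wpDl ?addr_ge0.
  have := h _ (divr_gt0 a0 n0); rewrite mulrA ler_pdivlMr//; nra.
apply: complex_eq; apply/eqP; rewrite -subr_eq0 -normr_le0; apply: arch => e e0;
  have [n [/ltW hu /ltW hv]] := small _ e0.
- have -> : complex.Re (ip x l) - complex.Re (ip y k)
      = re y (v n - k) - re x (u n - l).
    by rewrite !(reDr hh) !(reNr hh) /reform uv; ring.
  apply: le_trans (ler_normB _ _) _.
  apply: le_trans (lerD (re_le_norm _ _) (re_le_norm _ _)) _.
  by rewrite mulrDl addrC lerD ?ler_wpM2l.
- have -> : complex.Im (ip x l) - complex.Im (ip y k)
      = im y (v n - k) - im x (u n - l).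
    by rewrite !(imDr hh) !(imNr hh) /imform uv; ring.
  apply: le_trans (ler_normB _ _) _.
  apply: le_trans (lerD (im_le_norm _ _) (im_le_norm _ _)) _.
  by rewrite mulrDl addrC lerD ?ler_wpM2l.
Qed.

(** An element v of [S] within |x| / 2 of a nonzero x would give |x|^2 = re (x - v) x <= |x|^2 /
    2. *)
Lemma dense_ortho (S : set H) x :
  dense_set ip S -> (forall w, S w -> re w x = 0) -> x = 0.
Proof.
move=> dS ox; apply: ipnorm_eq0; apply/eqP; apply: contraT => n0.
have p : 0 < norm x by rewrite lt_def n0 ipnorm_ge0.
have p2 : 0 < norm x / 2 by rewrite divr_gt0.
have [v Sv hv] := dS x _ p2.
have : re x x = re (x - v) x by rewrite (reDl hh) (reNl hh) (ox v Sv) subr0.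
rewrite -ipnorm_sqr => e.
have := le_trans (ler_norm _) (re_le_norm (x - v) x).
by rewrite -e; nra.
Qed.

End Norm.

(** * The bounded operator B, its norm and its form *)

Section BoundedOperator.
Variables (R : realType) (H : lmodType R[i]) (ip : H -> H -> R[i]) (B : H -> H).
Hypothesis hip : inner_product_axioms ip.
Hypothesis hB : bounded_nonneg ip B.
Notation norm := (ipnorm ip).
Let hh := ip_hermitian hip.

Lemma boundedD x y : B (x + y) = B x + B y.
Proof. by case: hB => -[_ l _] _ _ _; case: (l x y). Qed.

Lemma boundedZ a x : B (a *: x) = a *: B x.
Proof. by case: hB => -[_ _ l] _ _ _; case: (l a x). Qed.

Lemma boundedN x : B (- x) = - B x.
Proof. by rewrite -scaleN1r boundedZ scaleN1r. Qed.

Lemma bounded_sym x y : ip (B x) y = ip x (B y).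
Proof. by case: hB. Qed.

(** Provides Cauchy-Schwarz and the rest of the form calculus for the seminorm <x, Bx>^(1/2), in
    which the Cayley operator will be a contraction. *)
Lemma bounded_form_hermitian : hermitian_nonneg (fun x y => ip x (B y)).
Proof.
case: hip => l c _ _; case: (hB) => _ _ s p; split=> //.
  by move=> x y z a; rewrite boundedD boundedZ l.
by move=> x y; rewrite -s c.
Qed.

Let opset := [set norm (B x) | x in [set x | norm x <= 1]].

Let has_sup_opset : has_sup opset.
Proof.
case: hB => _ [M hM] _ _; split.
  exists (norm (B 0)); exists 0 => //=.
  by rewrite -(scale0r 0) ipnormZ //= expr0n addr0 sqrtr0 mul0r ler01.
exists `|M| => _ [x /= x1 <-]; apply: le_trans (hM x) _.
apply: le_trans (ler_wpM2r (ipnorm_ge0 _ _) (ler_norm M)) _.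
by rewrite -[leRHS]mulr1 ler_wpM2l.
Qed.

Lemma opnorm_ge0 : 0 <= opnorm ip B.
Proof.
apply: le_trans (ipnorm_ge0 ip (B 0)) _.
apply: ub_le_sup; first by case: has_sup_opset.
exists 0 => //=.
by rewrite -(scale0r 0) ipnormZ //= expr0n addr0 sqrtr0 mul0r ler01.
Qed.

Lemma opnormP x : norm (B x) <= opnorm ip B * norm x.
Proof.
have [n0|n0] := eqVneq (norm x) 0.
  move: (n0); rewrite (ipnorm_eq0 hip n0) => n00.
  have {1}-> : (0 : H) = (0 : R[i]) *: 0 by rewrite scale0r.
  by rewrite boundedZ scale0r n00 mulr0.
have p : 0 < norm x by rewrite lt_def n0 ipnorm_ge0.
rewrite -ler_pdivrMr//; apply: ub_le_sup; first by case: has_sup_opset.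
exists ((((norm x)^-1)%:C)%C *: x) => /=.
  by rewrite ipnormZr// ger0_norm ?invr_ge0 ?ipnorm_ge0// mulVf.
by rewrite boundedZ ipnormZr// ger0_norm ?invr_ge0 ?ipnorm_ge0// mulrC.
Qed.

Lemma ip_cvg_bounded u x : ip_cvg ip u x -> ip_cvg ip (B \o u) (B x).
Proof.
apply: (ip_cvg_lipschitz (c := opnorm ip B)) => y.
by rewrite -boundedN -boundedD; exact: opnormP.
Qed.

Lemma bounded_form_le x : reform ip x (B x) <= opnorm ip B * norm x ^+ 2.
Proof.
apply: le_trans (ler_norm _) _; apply: le_trans (re_le_norm hip _ _) _.
by have := opnormP x; have := ipnorm_ge0 ip x; nra.
Qed.

End BoundedOperator.

(** * The operators A + zB - i *)

(** If a is nonzero, then at t = -a / (|c| + 1) the expression has the sign of c - 2 (|c| + 1),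
    which is negative. This is the first-order condition at a minimum. *)
Lemma quadratic_ge0_linear_eq0 (R : realFieldType) (a c : R) :
  (forall t, 0 <= 2 * t * a + t ^+ 2 * c) -> a = 0.
Proof.
move=> h; apply/eqP; apply: contraT => a0.
have c1 : 0 < `|c| + 1 by rewrite ltr_wpDl.
have := h (- a / (`|c| + 1)).
have -> : 2 * (- a / (`|c| + 1)) * a + (- a / (`|c| + 1)) ^+ 2 * c =
    a ^+ 2 / (`|c| + 1) ^+ 2 * (c - 2 * (`|c| + 1)).
  by field; rewrite gt_eqF.
have p : 0 < a ^+ 2 / (`|c| + 1) ^+ 2.
  by apply: divr_gt0; rewrite ?(exprn_gt0 _ c1)// lt_def sqrf_eq0 a0 sqr_ge0.
by rewrite pmulr_rge0//; have := ler_norm c; have := normr_ge0 c; lra.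
Qed.

Section Resolvent.
Variables (R : realType) (H : lmodType R[i]) (ip : H -> H -> R[i]).
Variables (D : set H) (A B : H -> H).
Hypothesis hip : inner_product_axioms ip.
Hypothesis hC : complete_ip ip.
Hypothesis hA : selfadjoint ip D A.
Hypothesis hB : bounded_nonneg ip B.
Notation re := (reform ip).
Notation im := (imform ip).
Notation norm := (ipnorm ip).
Notation beta := (opnorm ip B).
Let hh := ip_hermitian hip.

Lemma domD x y : D x -> D y -> D (x + y).
Proof. by case: hA => -[_ l _] _ _ _ Dx Dy; case: (l x y Dx Dy). Qed.

Lemma domZ a x : D x -> D (a *: x).
Proof. by case: hA => -[_ _ l] _ _ _ Dx; case: (l a x Dx). Qed.

Lemma dom0 : D 0. Proof. by case: hA => -[]. Qed.

Lemma domN x : D x -> D (- x).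
Proof. by rewrite -scaleN1r; exact: domZ. Qed.

Lemma opD x y : D x -> D y -> A (x + y) = A x + A y.
Proof. by case: hA => -[_ l _] _ _ _ Dx Dy; case: (l x y Dx Dy). Qed.

Lemma opZ a x : D x -> A (a *: x) = a *: A x.
Proof. by case: hA => -[_ _ l] _ _ _ Dx; case: (l a x Dx). Qed.

Lemma op_sym x y : D x -> D y -> ip (A x) y = ip x (A y).
Proof. by case: hA => _ _ s _; exact: s. Qed.

Lemma op_im x : D x -> im x (A x) = 0.
Proof.
move=> Dx; have := imC hh x (A x).
by rewrite {1}/imform op_sym// -/(im _ _); lra.
Qed.

Lemma bounded_im x : im x (B x) = 0.
Proof. exact: im_diag (bounded_form_hermitian hip hB) x. Qed.

Lemma bounded_re_ge0 x : 0 <= re x (B x).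
Proof. exact: re_ge0 (bounded_form_hermitian hip hB) x. Qed.

(** The identity <Av, u_n> = <v, A u_n> passes to the limit for each v in D; the adjoint condition
    then puts x in D, and density of D identifies A x. *)
Lemma op_closed u x y : (forall n, D (u n)) ->
  ip_cvg ip u x -> ip_cvg ip (A \o u) y -> D x /\ A x = y.
Proof.
move=> Du ux uy; case: (hA) => _ dD _ adj.
have key v : D v -> ip (A v) x = ip v y.
  move=> Dv; apply: (ip_cvg_form hip (v := A \o u)) ux uy => n /=.
  exact: op_sym.
have Dx : D x by apply: adj key.
split=> //; apply/eqP; rewrite -subr_eq0; apply/eqP.
apply: (dense_ortho hip dD) => v Dv.
by rewrite (reDr hh) (reNr hh) /reform -op_sym// key// subrr.
Qed.

(** The operator A + zB - i. For real z = s and T = A + sB it is the factor T - i of T^2 + 1 = (T -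
    i)(T + i). *)
Definition dissip (z : R[i]) (x : H) := A x + z *: B x - Complex 0 1 *: x.

Lemma dissipD z x y : D x -> D y -> dissip z (x + y) = dissip z x + dissip z y.
Proof.
move=> Dx Dy; rewrite /dissip opD// (boundedD hB) !scalerDr opprD.
by rewrite [X in X + _ = _]addrACA [LHS]addrACA.
Qed.

Lemma dissipZ z a x : D x -> dissip z (a *: x) = a *: dissip z x.
Proof.
move=> Dx; rewrite /dissip opZ// (boundedZ hB) !scalerDr scalerN.
by rewrite !scalerA ![_ * a]mulrC.
Qed.

Lemma dissipB z x y : D x -> D y -> dissip z (x - y) = dissip z x - dissip z y.
Proof.
move=> Dx Dy; rewrite dissipD//; last exact: domN.
by rewrite -[- y]scaleN1r dissipZ// scaleN1r.
Qed.

Lemma dissip_shift z t x : dissip (z + t) x = dissip z x + t *: B x.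
Proof. by rewrite /dissip scalerDl addrA [LHS]addrAC. Qed.

(** Both <x, Ax> and <x, Bx> are real, so only the term -i and the imaginary part of z
    contribute. *)
Lemma dissip_im z x : D x ->
  - im x (dissip z x) = re x x - complex.Im z * re x (B x).
Proof.
move=> Dx; rewrite /dissip !(imDr hh) (imNr hh) !(imZr hh) /= op_im// bounded_im.
by ring.
Qed.

Lemma dissip_coercive z x : complex.Im z <= 0 -> D x ->
  re x x <= - im x (dissip z x).
Proof. by move=> z0 Dx; rewrite dissip_im//; have := bounded_re_ge0 x; nra. Qed.

Lemma dissip_norm z x : complex.Im z <= 0 -> D x -> norm x <= norm (dissip z x).
Proof.
move=> z0 Dx; have := dissip_coercive z0 Dx; rewrite -(ipnorm_sqr hip) => h.
have := le_trans (ler_norm _) (im_le_norm hip x (- dissip z x)).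
rewrite (imNr hh) (ipnormN hip) => h2.
have [->|n0] := eqVneq (norm x) 0; first exact: ipnorm_ge0.
rewrite -(ler_pM2l (x := norm x)) ?lt_def ?n0 ?ipnorm_ge0//.
by rewrite -expr2; exact: le_trans h h2.
Qed.

Lemma dissip_inj z x y : complex.Im z <= 0 -> D x -> D y ->
  dissip z x = dissip z y -> x = y.
Proof.
move=> z0 Dx Dy e; apply/eqP; rewrite -subr_eq0; apply/eqP/(ipnorm_eq0 hip).
apply/eqP; rewrite eq_le ipnorm_ge0 andbT.
apply: le_trans (dissip_norm z0 (domD Dx (domN Dy))) _.
by rewrite dissipB// e subrr -(scale0r 0) (ipnormZ hip) /= expr0n addr0 sqrtr0 mul0r.
Qed.

Lemma dissip_closed z u x y : (forall n, D (u n)) ->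
  ip_cvg ip u x -> ip_cvg ip (dissip z \o u) y -> D x /\ dissip z x = y.
Proof.
move=> Du ux uy.
have [|Dx Ax] := op_closed (y := y - z *: B x + Complex 0 1 *: x) Du ux.
  have := ip_cvgD hip (ip_cvgD hip uy (ip_cvgZ hip (- z) (ip_cvg_bounded hip hB ux)))
    (ip_cvgZ hip (Complex 0 1) ux).
  rewrite scaleNr; congr (ip_cvg _ _ _); apply/funext => n /=.
  by rewrite /dissip scaleNr addrAC subrK addrK.
by split=> //; rewrite /dissip Ax addrAC addrK subrK.
Qed.

(** Self-adjointness turns the orthogonality into e in D with A e = k, the value on e of -(conj z) B
    - i. Since <e, Ae> is real, |e|^2 = Im z <e, Be> <= 0. *)
Lemma dissip_cokernel z e : complex.Im z <= 0 ->
  (forall v, D v -> ip e (dissip z v) = 0) -> e = 0.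
Proof.
move=> z0 oe; case: (hA) => _ dD _ adj; case: (hip) => _ cj _ _.
set k := - (conjc z *: B e) - Complex 0 1 *: e.
have key v : D v -> ip (A v) e = ip v k.
  move=> Dv; have := oe v Dv; rewrite /dissip => h.
  have hr : re e (A v + z *: B v - Complex 0 1 *: v) = 0 by rewrite /reform h.
  have hi : im e (A v + z *: B v - Complex 0 1 *: v) = 0 by rewrite /imform h.
  move: hr hi; rewrite !(formE hh) /= => hr hi.
  have rB : re v (B e) = re e (B v).
    by rewrite (reC hh) /reform (bounded_sym hB).
  have iB : im v (B e) = - im e (B v).
    by rewrite (imC hh) /imform (bounded_sym hB).
  apply: complex_eq.
    rewrite -/(re (A v) e) -/(re v k) /k !(formE hh) cReJ cImJ /= rB iB.
    by rewrite (reC hh) (reC hh e v) (imC hh e v); lra.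
  rewrite -/(im (A v) e) -/(im v k) /k !(formE hh) cReJ cImJ /= rB iB.
  by rewrite (imC hh) (reC hh e v) (imC hh e v); lra.
have De : D e by apply: adj key.
have Ae : A e = k.
  apply/eqP; rewrite -subr_eq0; apply/eqP.
  apply: (dense_ortho hip dD) => v Dv.
  by rewrite (reDr hh) (reNr hh) /reform -op_sym// key// subrr.
apply: (re_diag_eq0 hip); have := op_im De; rewrite Ae /k !(formE hh) cImJ cReJ /=.
by rewrite bounded_im; have := bounded_re_ge0 e; have := re_ge0 hh e; nra.
Qed.

(* The range is closed by coercivity; a minimiser of the distance to [psi] exists by the parallelogram law and leaves a residual in the cokernel. *)
Lemma dissip_surj z psi : complex.Im z <= 0 -> exists2 x, D x & dissip z x = psi.
Proof.
move=> z0.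
pose E := [set norm (dissip z v - psi) | v in D].
have hE : has_inf E.
  split; first by exists (norm (dissip z 0 - psi)); exists 0 => //; exact: dom0.
  by exists 0 => _ [v _ <-]; exact: ipnorm_ge0.
pose d := inf E.
have dE v : D v -> d <= norm (dissip z v - psi).
  by move=> Dv; apply: ge_inf; [case: hE|exists v].
have d0 : 0 <= d by apply: lb_le_inf => [|_ [v _ <-]]; [case: hE|exact: ipnorm_ge0].
have near n : exists v, D v /\ norm (dissip z v - psi) < d + n.+1%:R^-1.
  have p : 0 < (n.+1%:R^-1 : R) by rewrite invr_gt0.
  by have [_ [v Dv <-] h] := inf_adherent p hE; exists v.
pose u n := projT1 (cid (near n)).
have hu n : D (u n) /\ norm (dissip z (u n) - psi) < d + n.+1%:R^-1.
  exact: projT2 (cid (near n)).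
have Du n : D (u n) by case: (hu n).
have cau (e : R) : 0 < e -> exists N : nat, forall m n : nat, (N <= m)%N -> (N <= n)%N ->
    norm (dissip z (u m) - dissip z (u n)) < e.
  (* For residuals p, q of norm at most d + x with |p + q| >= 2d, the parallelogram law gives |p -
     q|^2 <= 4 (d + x)^2 - 4 d^2 <= (8d + 4) x, strictly below (8d + 5) x <= e^2. *)
  move=> e0; pose x := Num.min 1 (e ^+ 2 / (8 * d + 5)).
  have c0 : 0 < 8 * d + 5 by lra.
  have x0 : 0 < x by rewrite lt_min ltr01 divr_gt0// exprn_gt0.
  have x1 : x <= 1 by rewrite ge_min lexx.
  have xe : (8 * d + 5) * x <= e ^+ 2.
    by rewrite mulrC -ler_pdivlMr// ge_min lexx orbT.
  have [N hN] : exists N : nat, N.+1%:R^-1 < x.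
    exists (Num.truncn x^-1); rewrite invf_plt ?posrE//.
    by exact: truncnS_gt.
  have hx n : (N <= n)%N -> norm (dissip z (u n) - psi) <= d + x.
    move=> Nn; case: (hu n) => _ /ltW h; apply: le_trans h _; rewrite lerD2l.
    apply: le_trans (ltW hN); rewrite lef_pV2 ?posrE// ler_nat ltnS//.
  exists N => m n Nm Nn.
  set p := dissip z (u m) - psi; set q := dissip z (u n) - psi.
  have -> : dissip z (u m) - dissip z (u n) = p - q by rewrite /p /q; move: (dissip z (u n)) => b; rewrite opprB addrA subrK.
  (* The midpoint of [u m] and [u n] lies in D, and its residual is (p + q) / 2. *)
  have hs : 2 * d <= norm (p + q).
    have h2 : (((1 / 2 : R)%:C)%C + ((1 / 2)%:C)%C : R[i]) = 1.
      by apply: complex_eq => /=; lra.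
    have := dE _ (domZ ((1 / 2 : R)%:C)%C (domD (Du m) (Du n))).
    rewrite dissipZ ?dissipD//; last exact: domD.
    have -> : ((1 / 2 : R)%:C)%C *: (dissip z (u m) + dissip z (u n)) - psi =
        ((1 / 2 : R)%:C)%C *: (p + q).
      rewrite /p /q; move: (dissip z (u m)) (dissip z (u n)) => a b.
      rewrite [X in _ = _ *: X]addrACA -opprD [RHS]scalerBr; congr (_ - _).
      by rewrite scalerDr -scalerDl h2 scale1r.
    by rewrite (ipnormZr hip) ger0_norm; lra.
  rewrite -(ltr_pXn2r (n := 2)) ?nnegrE ?ipnorm_ge0 ?(ltW e0)// (ipnorm_sqr hip).
  have := hx m Nm; have := hx n Nn; rewrite -/p -/q => hq hp.
  have np := ipnorm_ge0 ip p; have nq := ipnorm_ge0 ip q.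
  have par : re (p - q) (p - q) = 2 * norm p ^+ 2 + 2 * norm q ^+ 2 - norm (p + q) ^+ 2.
    by rewrite !(ipnorm_sqr hip) (re_parallelogram hh).
  rewrite par.
  have p2 : norm p ^+ 2 <= (d + x) ^+ 2 by rewrite ler_pXn2r ?nnegrE//; lra.
  have q2 : norm q ^+ 2 <= (d + x) ^+ 2 by rewrite ler_pXn2r ?nnegrE//; lra.
  have s2 : (2 * d) ^+ 2 <= norm (p + q) ^+ 2.
    by rewrite ler_pXn2r ?nnegrE ?ipnorm_ge0//; lra.
  have : x ^+ 2 <= x by rewrite expr2 ger_pMr.
  by nra.
have [y uy] := hC (u := dissip z \o u) cau.
have [e' e0|x ux] := hC (u := u).
  have [N hN] := cau _ e0; exists N => m n Nm Nn.
  apply: le_lt_trans (hN m n Nm Nn).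
  by rewrite -dissipB//; apply: dissip_norm => //; apply: domD => //; exact: domN.
have [Dx Mx] := dissip_closed Du ux uy.
exists x => //; apply/eqP; rewrite -subr_eq0; apply/eqP.
have yd : norm (y - psi) <= d.
  suff h (e : R) : 0 < e -> norm (y - psi) <= d + e by apply/ler_addgt0Pr.
  move=> e0; have e2 : 0 < e / 2 by rewrite divr_gt0.
  have [N hN] := uy _ e2.
  pose n := maxn N (Num.truncn (e / 2)^-1).
  have hn : (n.+1%:R^-1 : R) < e / 2.
    rewrite invf_plt ?posrE//; apply: lt_le_trans (truncnS_gt _) _.
    by rewrite ler_nat ltnS leq_maxr.
  have := hN n (leq_maxl _ _); case: (hu n) => _ h1 /=; rewrite (ipnormB hip _ y) => h2.
  have -> : y - psi = (y - dissip z (u n)) + (dissip z (u n) - psi) by rewrite addrA subrK.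
  apply: le_trans (ipnormD hip _ _) _.
  by move: (n.+1%:R^-1) h1 hn => k h1 hn; lra.
rewrite Mx; apply: (dissip_cokernel z0) => v0 Dv0.
(* First variation: adding t times [dissip z v] to the minimal residual cannot shorten it. *)
have ort v : D v -> re (y - psi) (dissip z v) = 0.
  move=> Dv; apply: (@quadratic_ge0_linear_eq0 _ _ (re (dissip z v) (dissip z v))) => t.
  have := dE _ (domD Dx (domZ (t%:C)%C Dv)).
  rewrite dissipD ?dissipZ// ?Mx; last exact: domZ.
  rewrite addrAC => /(le_trans yd).
  rewrite -(ler_pXn2r (n := 2)) ?nnegrE ?ipnorm_ge0// !(ipnorm_sqr hip).
  rewrite (re_sqrD hh (y - psi)) (re_sqrZ hh) (reZr hh (y - psi)) /= expr0n /=; lra.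
apply: complex_eq; first exact: ort.
(* Replacing [v0] by i times [v0] turns the vanishing real part into a vanishing imaginary part. *)
have := ort _ (domZ (Complex 0 1) Dv0); rewrite dissipZ// (reZr hh) /= -/(im _ _).
by lra.
Qed.

End Resolvent.

(** * The Cayley transform *)

Definition sqmod (R : realType) (a : R[i]) := complex.Re a ^+ 2 + complex.Im a ^+ 2.

Lemma sqmod_ge0 (R : realType) (a : R[i]) : 0 <= sqmod a.
Proof. by rewrite addr_ge0 ?sqr_ge0. Qed.

Lemma sqmodM (R : realType) (a b : R[i]) : sqmod (a * b) = sqmod a * sqmod b.
Proof. by rewrite /sqmod cReM cImM; ring. Qed.

Lemma sqmodX (R : realType) (a : R[i]) n : sqmod (a ^+ n) = sqmod a ^+ n.
Proof.
elim: n => [|n IH]; first by rewrite !expr0 /sqmod /= expr1n expr0n addr0.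
by rewrite !exprS sqmodM IH.
Qed.

Lemma sqmodN (R : realType) (a : R[i]) : sqmod (- a) = sqmod a.
Proof. by rewrite /sqmod cReN cImN !sqrrN. Qed.

(** Here t is the offset from the centre: -iY + t = -iY (1 - zeta) / (1 + zeta), whose imaginary
    part times |1 + zeta|^2 is Y (|zeta|^2 - 1). *)
Lemma cayley_half_plane (R : realType) (Y : R) (zeta t : R[i]) :
  0 < Y -> sqmod zeta <= 1 -> 1 + zeta != 0 ->
  t * (1 + zeta) = Complex 0 (2 * Y) * zeta ->
  complex.Im (- Complex 0 Y + t) <= 0.
Proof.
case: zeta t => x y [a b]; rewrite /sqmod /= => Y0 h n0 [h1 h2].
have N0 : 0 < (1 + x) ^+ 2 + y ^+ 2.
  rewrite lt_def addr_ge0 ?sqr_ge0// andbT paddr_eq0 ?sqr_ge0// !sqrf_eq0.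
  apply: contra n0 => /andP[/eqP h3 /eqP h4]; apply/eqP.
  by apply: complex_eq => /=; lra.
rewrite -(pmulr_lle0 _ N0).
have -> : (- Y + b) * ((1 + x) ^+ 2 + y ^+ 2) = Y * (x ^+ 2 + y ^+ 2 - 1).
  have e1 : a * (1 + x) - b * y = - 2 * Y * y by move: h1; rewrite add0r; lra.
  have e2 : a * y + b * (1 + x) = 2 * Y * x.
    by move: h2; rewrite add0r; lra.
  have -> : (- Y + b) * ((1 + x) ^+ 2 + y ^+ 2) = (a * y + b * (1 + x)) * (1 + x)
      - (a * (1 + x) - b * y) * y - Y * ((1 + x) ^+ 2 + y ^+ 2) by ring.
  by rewrite e1 e2; ring.
by nra.
Qed.

(** * Comparison of solutions, and the summand as a squared norm *)

Section Comparison.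
Variables (R : realType) (H : lmodType R[i]) (ip : H -> H -> R[i]).
Variables (D : set H) (A B : H -> H).
Hypothesis hip : inner_product_axioms ip.
Hypothesis hC : complete_ip ip.
Hypothesis hA : selfadjoint ip D A.
Hypothesis hB : bounded_nonneg ip B.
Notation re := (reform ip).
Notation im := (imform ip).
Notation norm := (ipnorm ip).
Notation beta := (opnorm ip B).
Notation dissip := (dissip A B).
Let hh := ip_hermitian hip.

(** Resolvent identity: the operator at z sends x - y to -(z - z') By, and coercivity at z bounds x
    - y by this image. *)
Lemma dissip_compare z z' x y : complex.Im z <= 0 -> D x -> D y ->
  dissip z x = dissip z' y ->
  norm x <= (1 + beta * Num.sqrt (sqmod (z - z'))) * norm y.
Proof.
move=> z0 Dx Dy e.
have d : dissip z (x - y) = - ((z - z') *: B y).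
  rewrite (dissipB hA hB)// e -{1}[z](subrK z') [z - z' + z']addrC dissip_shift.
  by rewrite opprD addrA subrr sub0r.
have := dissip_norm hip hA hB z0 (domD hA Dx (domN hA Dy)).
rewrite d (ipnormN hip) (ipnormZ hip) -/(sqmod _) => h.
have -> : x = y + (x - y) by rewrite addrC subrK.
apply: le_trans (ipnormD hip _ _) _; rewrite mulrDl mul1r lerD2l.
apply: le_trans h _; rewrite mulrAC [leRHS]mulrC.
by rewrite ler_wpM2l ?sqrtr_ge0 ?(opnormP hip hB).
Qed.

(** With T = A + sB and w the solution of (T^2 + 1) w = psi, factoring gives v = (T + i) w, whence
    <psi, w> = |Tw|^2 + |w|^2 = |v|^2. *)
Lemma sq1inv_le (s : R) (psi v : H) : D v -> dissip (s%:C)%C v = psi ->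
  complex.Re (ip psi (sq1inv D (fun x => A x + (s%:C)%C *: B x) psi))
    <= norm v ^+ 2.
Proof.
move=> Dv ev; rewrite /sq1inv.
set T := fun x => A x + (s%:C)%C *: B x.
case: xgetP => [w _ [Dw [DTw Tw]]|_]; last first.
  (* If no solution exists, [sq1inv] is its default 0 and the left side vanishes. *)
  have -> : (0 : H) = (0 : R[i]) *: psi by rewrite scale0r.
  by rewrite -/(re _ _) (reZr hh) /= !mul0r subrr sqr_ge0.
have symT x y : D x -> D y -> ip (T x) y = ip x (T y).
  move=> Dx Dy; case: (hip) => l c _ _.
  apply: complex_eq.
    rewrite -/(re _ _) -/(re x _) /T (reDl hh) (reDr hh) (reZl hh) (reZr hh) /=.
    by rewrite /reform (op_sym hA)// (bounded_sym hB); ring.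
  rewrite -/(im _ _) -/(im x _) /T (imDl hh) (imDr hh) (imZl hh) (imZr hh) /=.
  by rewrite /imform (op_sym hA)// (bounded_sym hB); ring.
have linT x y a : D x -> D y -> T (x + a *: y) = T x + a *: T y.
  move=> Dx Dy; rewrite /T (opD hA)//; last exact: (domZ hA).
  rewrite (opZ hA)// (boundedD hB) (boundedZ hB) !scalerDr [LHS]addrACA.
  by rewrite !scalerA [a * _]mulrC.
have dT x : dissip (s%:C)%C x = T x - Complex 0 1 *: x by [].
have {}DTw : D (T w) := DTw.
have {}Tw : T (T w) + w = psi := Tw.
clearbody T.
have imT : im (T w) w = 0.
  by have := imC hh w (T w); rewrite {2}/imform -symT// -/(im (T w) w); lra.
(* Both sides have image psi under the injective T - i. *)
have -> : v = T w + Complex 0 1 *: w.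
  apply: (dissip_inj hip hA hB (z := (s%:C)%C)) => //.
    by apply: (domD hA) => //; exact: (domZ hA).
  rewrite ev -Tw dT linT// scalerDr opprD [RHS]addrA addrK scalerA -scaleNr.
  have -> : - (Complex 0 1 * Complex 0 1) = 1 :> R[i].
    by apply: complex_eq => /=; ring.
  by rewrite scale1r.
rewrite (ipnorm_sqr hip) -Tw -/(re _ _) (reDl hh) {1}/reform symT// -/(re _ _).
by rewrite (re_sqrD hh) (re_sqrZ hh) (reZr hh) /= imT expr1n expr0n /=; lra.
Qed.

End Comparison.

(** * The power series in the Cayley variable *)

Section Cayley.
Variables (R : realType) (H : lmodType R[i]) (ip : H -> H -> R[i]).
Variables (D : set H) (A B : H -> H).
Hypothesis hip : inner_product_axioms ip.
Hypothesis hC : complete_ip ip.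
Hypothesis hA : selfadjoint ip D A.
Hypothesis hB : bounded_nonneg ip B.
Variable Y : R.
Hypothesis Y0 : 0 < Y.
Let ipB x y := ip x (B y).
Notation re := (reform ip).
Notation im := (imform ip).
Notation reB := (reform ipB).
Notation imB := (imform ipB).
Notation norm := (ipnorm ip).
Notation beta := (opnorm ip B).
Notation dissip := (dissip A B).
Notation iY := (Complex 0 Y).
Let hh := ip_hermitian hip.
Let hhB : hermitian_nonneg ipB := bounded_form_hermitian hip hB.

Let iY_le0 : complex.Im (- iY) <= 0.
Proof. by rewrite /= oppr_le0 ltW. Qed.

Definition resX (x : H) : H :=
  projT1 (cid2 (dissip_surj hip hC hA hB (B x) iY_le0)).

Lemma resX_dom x : D (resX x).
Proof. by rewrite /resX; case: cid2. Qed.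

Lemma resXE x : dissip (- iY) (resX x) = B x.
Proof. by rewrite /resX; case: cid2. Qed.

Let uniq x y : D x -> D y -> dissip (- iY) x = dissip (- iY) y -> x = y.
Proof. exact: (dissip_inj hip hA hB iY_le0). Qed.

Lemma resXD x y : resX (x + y) = resX x + resX y.
Proof.
apply: uniq; [exact: resX_dom|by apply: (domD hA); exact: resX_dom|].
by rewrite (dissipD hA hB) ?resXE ?(boundedD hB)//; exact: resX_dom.
Qed.

Lemma resXZ a x : resX (a *: x) = a *: resX x.
Proof.
apply: uniq; [exact: resX_dom|exact: (domZ hA) (resX_dom _)|].
by rewrite (dissipZ hA hB) ?resXE ?(boundedZ hB)//; exact: resX_dom.
Qed.

(** The energy identity [dissip_im] at z = -iY, applied to X x; the two bounds below are rewritings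
    of it. *)
Lemma resX_im x : imB x (resX x) = re (resX x) (resX x) + Y * reB (resX x) (resX x).
Proof.
have := dissip_im hip hA hB (- iY) (resX_dom x); rewrite resXE /=.
by rewrite (imC hhB) /reform /imform /ipB => ->; ring.
Qed.

(** Expand the nonnegative B-form at x + iY X x and eliminate its quadratic term with [resX_im]. *)
Lemma resX_im_le x : imB x (resX x) <= reB x x / Y.
Proof.
rewrite ler_pdivlMr//.
have := re_ge0 hhB (x + iY *: resX x).
rewrite (re_sqrD hhB) (re_sqrZ hhB) (reZr hhB) /= resX_im.
by have := mulr_ge0 (ltW Y0) (re_ge0 hh (resX x)); lra.
Qed.

(** On D this is (A - iYB - i)^-1 (A + iYB - i). *)
Definition cayV (x : H) : H := x + Complex 0 (2 * Y) *: resX x.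

(** By [resX_im] the B-form drops by exactly 4Y |X x|^2. *)
Lemma cayV_contraction x : reB (cayV x) (cayV x) <= reB x x.
Proof.
rewrite /cayV (re_sqrD hhB) (re_sqrZ hhB) (reZr hhB) /= resX_im.
by have := mulr_ge0 (ltW Y0) (re_ge0 hh (resX x)); lra.
Qed.

Lemma iter_cayV_contraction k x : reB (iter k cayV x) (iter k cayV x) <= reB x x.
Proof. by elim: k => //= k; exact/le_trans/cayV_contraction. Qed.

Lemma cayVD x y : cayV (x + y) = cayV x + cayV y.
Proof. by rewrite /cayV resXD scalerDr addrACA. Qed.

Lemma cayVZ a x : cayV (a *: x) = a *: cayV x.
Proof. by rewrite /cayV resXZ scalerDr !scalerA [in X in _ + X]mulrC. Qed.

Variable phi : H.

Definition cayley_coef k : R[i] := ipB phi (iter k cayV (resX phi)).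

(** The truncation of <phi, Bw> obtained by iterating w = (1 + zeta) X phi - zeta V w; being a
    polynomial in zeta, it has an explicit primitive along circles. *)
Definition cayley_poly K : {poly R[i]} :=
  \sum_(k < K) (cayley_coef k)%:P * ((1 + 'X) * (- 'X) ^+ k).

Lemma cayley_poly0 K : (0 < K)%N -> (cayley_poly K).[0] = ipB phi (resX phi).
Proof.
case: K => // K _; rewrite /cayley_poly horner_sum big_ord_recl big1 /=.
  rewrite expr0 hornerM !hornerC hornerM hornerD hornerX (hornerC 1).
  by rewrite addr0 [1 + 0]addr0 !mulr1.
move=> k _; have -> : bump 0 k = k.+1 by [].
by rewrite exprS !hornerM hornerN hornerX oppr0 mul0r !mulr0.
Qed.

Variables (zeta t : R[i]) (w : H).
Hypothesis t_zeta : t * (1 + zeta) = Complex 0 (2 * Y) * zeta.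
Hypothesis Dw : D w.
Hypothesis w_res : dissip (- iY + t) w = B phi.

(** Shifting the parameter by t gives w = X (phi - t w); multiply by 1 + zeta and replace t (1 +
    zeta) by 2iY zeta. *)
Lemma cayley_fixpoint : w = (1 + zeta) *: resX phi - zeta *: cayV w.
Proof.
have wX : w = resX (phi - t *: w).
  apply: uniq => //; first exact: resX_dom.
  rewrite resXE (boundedD hB) (boundedN hB) (boundedZ hB) -w_res dissip_shift.
  by rewrite addrK.
have e : (1 + zeta) *: w = (1 + zeta) *: resX phi - (zeta * Complex 0 (2 * Y)) *: resX w.
  rewrite {1}wX resXD -[- _]scaleN1r scalerA resXZ scalerDr; congr (_ + _).
  by rewrite scalerA -scaleNr mulN1r mulrN mulrC t_zeta [zeta * _]mulrC.
rewrite /cayV scalerDr scalerA opprD addrCA -e.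
by rewrite addrC scalerDl scale1r addrK.
Qed.

Lemma cayley_expansion K :
  w = \sum_(k < K) ((1 + zeta) * (- zeta) ^+ k) *: iter k cayV (resX phi)
      + (- zeta) ^+ K *: iter K cayV w.
Proof.
have iD k x y : iter k cayV (x + y) = iter k cayV x + iter k cayV y.
  by elim: k => //= k ->; exact: cayVD.
have iZ k a x : iter k cayV (a *: x) = a *: iter k cayV x.
  by elim: k => //= k ->; exact: cayVZ.
elim: K => [|K IH]; first by rewrite big_ord0 add0r expr0 scale1r.
rewrite big_ord_recr /= -addrA.
suff -> : ((1 + zeta) * (- zeta) ^+ K) *: iter K cayV (resX phi) +
    (- zeta) ^+ K.+1 *: cayV (iter K cayV w) = (- zeta) ^+ K *: iter K cayV w by [].
rewrite [in RHS]cayley_fixpoint iD -scaleNr !iZ -iterSr /= [RHS]scalerDr !scalerA.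
by rewrite exprSr [(1 + _) * _]mulrC.
Qed.

Hypothesis half_plane : complex.Im (- iY + t) <= 0.

(** The remainder is <phi, B V^K w> times (-zeta)^K. Cauchy-Schwarz for the B-form, the contraction
    property and |w| <= |B phi| make the bound depend on zeta only through its modulus. *)
Lemma cayley_remainder K :
  (imB phi w - complex.Im (cayley_poly K).[zeta]) ^+ 2
    <= reB phi phi * (beta * norm (B phi) ^+ 2) * sqmod zeta ^+ K.
Proof.
have lD x y a : ipB phi (a *: x + y) = a * ipB phi x + ipB phi y by case: hhB.
have l0 : ipB phi 0 = 0.
  have /eqP := lD 0 0 1; rewrite scale1r addr0 mul1r -subr_eq0 opprD addrA subrr.
  by rewrite sub0r oppr_eq0 => /eqP.
have lsum N : ipB phi (\sum_(k < N) ((1 + zeta) * (- zeta) ^+ k) *: iter k cayV (resX phi))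
    = (cayley_poly N).[zeta].
  elim: N => [|k IH]; first by rewrite /cayley_poly !big_ord0 l0 horner0.
  rewrite /cayley_poly !big_ord_recr /= addrC lD IH hornerD addrC; congr (_ + _).
  rewrite !hornerM hornerC mulrC hornerD horner_exp hornerN hornerX.
  by rewrite (hornerC 1).
have -> : imB phi w - complex.Im (cayley_poly K).[zeta]
    = imB phi ((- zeta) ^+ K *: iter K cayV w).
  rewrite {1}(cayley_expansion K) (imDr hhB) {1}/imform lsum.
  by rewrite addrAC subrr add0r.
set u := _ *: _.
apply: (@le_trans _ _ (reB phi phi * reB u u)).
  by apply: le_trans (form_cauchy_schwarz hhB phi u); rewrite lerDr sqr_ge0.
rewrite -mulrA ler_wpM2l ?(re_ge0 hhB)// /u (re_sqrZ hhB) -/(sqmod _) sqmodX sqmodN.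
rewrite mulrC ler_wpM2r ?exprn_ge0 ?sqmod_ge0//.
apply: le_trans (iter_cayV_contraction _ _) _.
apply: le_trans (bounded_form_le hip hB w) _.
rewrite ler_wpM2l ?(opnorm_ge0 hip hB)// ler_pXn2r ?nnegrE ?ipnorm_ge0//.
by rewrite -w_res; exact: (dissip_norm hip hA hB half_plane Dw).
Qed.

End Cayley.

(** * Primitives on the line and on the circle *)

Section RealAnalysis.
Variable R : realType.
Implicit Types (f Q q : R -> R) (a b s t : R).

Lemma derive_ge0_le f df a b : a <= b ->
  (forall x, x \in `[a, b]%R -> is_derive x 1 f (df x)) ->
  (forall x, x \in `[a, b]%R -> 0 <= df x) -> f a <= f b.
Proof.
move=> ab fd d0.
have dab x : x \in `]a, b[%R -> is_derive x 1 f (df x).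
  by move=> xab; apply: fd; move: xab; apply: subset_itv_oo_cc.
have cf : {within `[a, b], continuous f}.
  by apply: derivable_within_continuous => x xab; case: (fd x xab).
have [c cab e] := @MVT_segment R f df a b ab dab cf.
by rewrite -subr_ge0 e mulr_ge0 ?d0// subr_ge0.
Qed.

Lemma is_derive_harnack beta t : 0 < 1 + beta * t ->
  is_derive t 1 (fun u => u / (1 + beta * u)) ((1 + beta * t) ^- 2).
Proof.
move=> p.
have n0 : 1 + beta * t != 0 by rewrite gt_eqF.
have d1 : is_derive t 1 (fun u => 1 + beta * u) beta.
  by apply: is_derive_eq; rewrite /GRing.scale /=; ring.
have d2 := is_deriveV (f := fun u => 1 + beta * u) n0 d1.
by apply: is_derive_eq; rewrite /GRing.scale /=; field.
Qed.

(** A comparison of derivatives replaces integration: u / (1 + beta u) is a primitive of the weight,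
    used separately to the right and to the left of s. *)
Lemma harnack_interval Q q (beta F a s : R) : 0 <= beta -> 0 <= F ->
  a <= s <= a + 1 ->
  (forall t, t \in `[a, a + 1]%R -> is_derive t 1 Q (q t)) ->
  (forall t, t \in `[a, a + 1]%R -> F / (1 + beta * `|s - t|) ^+ 2 <= q t) ->
  F <= (1 + beta) * (Q (a + 1) - Q a).
Proof.
move=> b0 F0 /andP[as1 sa1] dQ qF.
have right_part : F * ((a + 1 - s) / (1 + beta * (a + 1 - s))) <= Q (a + 1) - Q s.
  pose g u := Q u - F * ((u - s) / (1 + beta * (u - s))).
  suff : g s <= g (a + 1) by rewrite /g subrr mul0r mulr0; lra.
  pose dg u := q u - F * (1 + beta * (u - s)) ^- 2.
  have dgP x : x \in `[s, a + 1]%R -> is_derive x 1 g (dg x).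
    rewrite in_itv /= => /andP[sx xa].
    have p : 0 < 1 + beta * (x - s) by rewrite ltr_wpDr// mulr_ge0// subr_ge0.
    have xi : x \in `[a, a + 1]%R by rewrite in_itv /= xa (le_trans as1 sx).
    have d1 := is_derive_harnack p.
    have d2 : is_derive x 1 (fun u => u - s) 1.
      by apply: is_derive_eq; rewrite /GRing.scale /=; ring.
    have d3 := is_derive1_comp (f := fun u => u / (1 + beta * u)) (g := fun u => u - s) d1 d2.
    have d4 := is_deriveB (dQ x xi) (is_deriveZ F d3).
    by apply: (is_derive_eq d4); rewrite /GRing.scale /= mulr1.
  apply: (derive_ge0_le sa1 dgP) => x.
  rewrite in_itv /= => /andP[sx xa]; rewrite subr_ge0.
  have xi : x \in `[a, a + 1]%R by rewrite in_itv /= xa (le_trans as1 sx).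
  by have := qF x xi; rewrite distrC ger0_norm ?subr_ge0.
have left_part : F * ((s - a) / (1 + beta * (s - a))) <= Q s - Q a.
  pose g u := Q u + F * ((s - u) / (1 + beta * (s - u))).
  suff : g a <= g s by rewrite /g subrr mul0r mulr0; lra.
  pose dg u := q u - F * (1 + beta * (s - u)) ^- 2.
  have dgP x : x \in `[a, s]%R -> is_derive x 1 g (dg x).
    rewrite in_itv /= => /andP[ax xs].
    have p : 0 < 1 + beta * (s - x) by rewrite ltr_wpDr// mulr_ge0// subr_ge0.
    have xi : x \in `[a, a + 1]%R by rewrite in_itv /= ax (le_trans xs sa1).
    have d1 := is_derive_harnack p.
    have d2 : is_derive x 1 (fun u => s - u) (-1).
      by apply: is_derive_eq; rewrite /GRing.scale /=; ring.
    have d3 := is_derive1_comp (f := fun u => u / (1 + beta * u)) (g := fun u => s - u) d1 d2.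
    have d4 := is_deriveD (dQ x xi) (is_deriveZ F d3).
    by apply: (is_derive_eq d4); rewrite /GRing.scale /= mulrN1 mulrN.
  apply: (derive_ge0_le as1 dgP) => x.
  rewrite in_itv /= => /andP[ax xs]; rewrite subr_ge0.
  have xi : x \in `[a, a + 1]%R by rewrite in_itv /= ax (le_trans xs sa1).
  by have := qF x xi; rewrite ger0_norm ?subr_ge0.
(* A piece of length u contributes at least F u / (1 + beta), and the two lengths add up to 1. *)
have frac u : 0 <= u <= 1 -> F * u / (1 + beta) <= F * (u / (1 + beta * u)).
  move=> /andP[u0 u1]; rewrite -mulrA ler_wpM2l// ler_wpM2l//.
  have p : 0 < 1 + beta * u by rewrite ltr_wpDr// mulr_ge0.
  by rewrite lef_pV2 ?posrE//; nra.
have f1 := frac (a + 1 - s); have f2 := frac (s - a).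
rewrite mulrC -ler_pdivrMr; last lra.
have -> : F / (1 + beta) = F * (a + 1 - s) / (1 + beta) + F * (s - a) / (1 + beta).
  by field; rewrite gt_eqF//; lra.
have {}f1 : F * (a + 1 - s) / (1 + beta) <= _ := le_trans (f1 _) right_part.
have {}f2 : F * (s - a) / (1 + beta) <= _ := le_trans (f2 _) left_part.
have := f1 ltac:(lra); have := f2 ltac:(lra).
lra.
Qed.

End RealAnalysis.

(** * Circles and the mean value property *)

Section Circle.
Variable R : realType.
Implicit Types (r th a : R).

(** The point r e^(-i th). The clockwise orientation makes the Cayley image at r = 1, namely Y tan
    (th / 2), increase with th. *)
Definition polar r th : R[i] := Complex (r * cos th) (- (r * sin th)).

Lemma sqmod_polar r th : sqmod (polar r th) = r ^+ 2.
Proof.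
rewrite /sqmod /polar /= sqrrN !exprMn -mulrDr cos2Dsin2 mulr1; reflexivity.
Qed.

Lemma polarX r th n :
  polar r th ^+ n = Complex (r ^+ n * cos (n%:R * th)) (- (r ^+ n * sin (n%:R * th))).
Proof.
elim: n => [|n IH].
  by rewrite !expr0 mul0r cos0 sin0; apply: complex_eq => /=; ring.
rewrite exprS IH /polar -natr1 mulrDl mul1r cosD sinD.
by apply: complex_eq => /=; rewrite exprS; ring.
Qed.

Lemma sin_nat_pi n : sin (n%:R * pi) = 0 :> R.
Proof.
elim: n => [|n IH]; first by rewrite mul0r sin0.
by rewrite -natr1 mulrDl mul1r sinD IH sinpi; ring.
Qed.

Lemma polar_primitive_mono r (a : R[i]) n : exists P : R -> R,
  (forall th, is_derive th 1 P (complex.Im (a * polar r th ^+ n))) /\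
  P pi - P (- pi) = if n is 0 then 2 * pi * complex.Im a else 0.
Proof.
case: n => [|n].
  exists (fun th => complex.Im a * th); split=> [th|]; last by ring.
  by apply: is_derive_eq; rewrite expr0 mulr1 /GRing.scale /=; ring.
pose k : R := n.+1%:R; have k0 : k != 0 by rewrite pnatr_eq0.
exists (fun th => r ^+ n.+1 / k * complex.Re a * cos (k * th)
  + r ^+ n.+1 / k * complex.Im a * sin (k * th)); split=> [th|].
  have dk : is_derive th 1 (fun u => k * u) k.
    by apply: is_derive_eq; rewrite /GRing.scale /=; ring.
  have dc := is_derive1_comp (f := cos) (g := fun u => k * u) (is_derive_cos _) dk.
  have ds := is_derive1_comp (f := sin) (g := fun u => k * u) (is_derive_sin _) dk.
  apply: (is_derive_eq (is_deriveD (is_deriveZ (r ^+ n.+1 / k * complex.Re a) dc)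
    (is_deriveZ (r ^+ n.+1 / k * complex.Im a) ds))).
  rewrite polarX cImM /= -/k /GRing.scale /=.
  by field.
by rewrite mulrN cosN sinN /k sin_nat_pi; ring.
Qed.

Lemma polar_primitive r (p : {poly R[i]}) : exists P : R -> R,
  (forall th, is_derive th 1 P (complex.Im p.[polar r th])) /\
  P pi - P (- pi) = 2 * pi * complex.Im p.[0].
Proof.
(* One term more than the size, so that the induction starts from the constant coefficient even for
   the zero polynomial. *)
suff [P [dP eP]] : exists P : R -> R,
    (forall th, is_derive th 1 P
      (complex.Im (\sum_(i < (size p).+1) p`_i * polar r th ^+ i))) /\
    P pi - P (- pi) = 2 * pi * complex.Im p`_0.
  exists P; split=> [th|]; last by rewrite horner_coef0.
  by rewrite (horner_coef_wide _ (leqnSn _)).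
elim: (size p) => [|n [P [dP eP]]].
  have [P [dP eP]] := polar_primitive_mono r p`_0 0.
  by exists P; split=> // th; rewrite big_ord_recr big_ord0 /= add0r.
have [Q [dQ eQ]] := polar_primitive_mono r p`_n.+1 n.+1.
exists (fun th => P th + Q th); split=> [th|]; last by move: eP eQ => /=; lra.
by rewrite big_ord_recr /= cImD; exact: is_deriveD.
Qed.

Lemma cos2_atan (x : R) : cos (2 * atan x) = (1 - x ^+ 2) / (1 + x ^+ 2).
Proof.
have p : 0 < 1 + x ^+ 2 by rewrite ltr_wpDr// sqr_ge0.
rewrite mulrC mulr_natr cos_mulr2n cos_atan exprVn sqr_sqrtr ?(ltW p)//.
by field; rewrite gt_eqF.
Qed.

Lemma sin2_atan (x : R) : sin (2 * atan x) = 2 * x / (1 + x ^+ 2).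
Proof.
have p : 0 < 1 + x ^+ 2 by rewrite ltr_wpDr// sqr_ge0.
have c0 : cos (atan x) != 0 by rewrite cos_atan invr_neq0// sqrtr_eq0 -ltNge.
have s : sin (atan x) = x * cos (atan x).
  by rewrite -{2}[x]atanK /tan divfK.
rewrite mulrC mulr_natr sin_mulr2n s mulrCA -expr2 cos_atan exprVn sqr_sqrtr ?(ltW p)//.
by rewrite -mulr_natr; field; rewrite gt_eqF.
Qed.

(* [t - iY] is the image of [polar r (2 * atan (s / Y))] under the Cayley transform, which at [r = 1] is [s]. *)
Lemma cayley_near (Y r s : R) (t : R[i]) : 0 < Y -> 0 <= r -> r < 1 ->
  t * (1 + polar r (2 * atan (s / Y))) = Complex 0 (2 * Y) * polar r (2 * atan (s / Y)) ->
  Num.sqrt (sqmod (t - Complex 0 Y - (s%:C)%C)) <= (1 - r) * (Y ^+ 2 + s ^+ 2) / Y.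
Proof.
move=> Y0 r0 r1.
have N0 : 0 < Y ^+ 2 + s ^+ 2 by rewrite ltr_wpDr ?sqr_ge0 ?exprn_gt0.
set zeta := polar _ _ => h.
(* Real and imaginary parts of (Y + is) zeta = r (Y - is). *)
have [ez1 ez2] : Y * complex.Re zeta - s * complex.Im zeta = r * Y /\
    s * complex.Re zeta + Y * complex.Im zeta = - (r * s).
  have n0 : Y ^+ 2 + s ^+ 2 != 0 by rewrite gt_eqF.
  by rewrite /= cos2_atan sin2_atan; split; field; rewrite n0 gt_eqF.
case: zeta t h ez1 ez2 => x0 y0 [a b] [h1 h2] /= ez1 ez2.
pose x := a - s; pose y := b - Y; set N := _ + _ in N0 *.
(* [e1] and [e2] are the real and imaginary parts of (t - iY - s) ((1 + r) Y + i (1 - r) s) = -i (1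
   - r) N. Squared moduli give [key], and the second factor has modulus at least Y. *)
have e1 : x * ((1 + r) * Y) - y * ((1 - r) * s) = 0.
  have -> : x * ((1 + r) * Y) - y * ((1 - r) * s) = a * (Y + r * Y) - b * (s + - (r * s))
    - 2 * Y * (r * s) by rewrite /x /y; ring.
  rewrite -ez1 -[in s + _]ez2 -[r * s]opprK -ez2.
  have -> : a * (Y + (Y * x0 - s * y0)) - b * (s + (s * x0 + Y * y0))
    - 2 * Y * - (s * x0 + Y * y0) = Y * (a * (1 + x0) - b * (0 + y0) + 2 * Y * y0)
    - s * (a * (0 + y0) + b * (1 + x0) - 2 * Y * x0) by ring.
  by rewrite h1 h2; ring.
have e2 : x * ((1 - r) * s) + y * ((1 + r) * Y) = - (1 - r) * N.
  have -> : x * ((1 - r) * s) + y * ((1 + r) * Y) = a * (s + - (r * s)) + b * (Y + r * Y)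
    - 2 * Y * (r * Y) - (1 - r) * N by rewrite /x /y /N; ring.
  rewrite -ez1 -ez2.
  have -> : a * (s + (s * x0 + Y * y0)) + b * (Y + (Y * x0 - s * y0)) -
    2 * Y * (Y * x0 - s * y0) - (1 - r) * N = s * (a * (1 + x0) - b * (0 + y0) + 2 * Y * y0)
    + Y * (a * (0 + y0) + b * (1 + x0) - 2 * Y * x0) - (1 - r) * N by ring.
  by rewrite h1 h2; ring.
have -> : sqmod (Complex a b - Complex 0 Y - (s%:C)%C) = x ^+ 2 + y ^+ 2.
  by rewrite /sqmod /= /x /y; ring.
have key : (x ^+ 2 + y ^+ 2) * (((1 + r) * Y) ^+ 2 + ((1 - r) * s) ^+ 2)
    = ((1 - r) * N) ^+ 2.
  have -> : (x ^+ 2 + y ^+ 2) * (((1 + r) * Y) ^+ 2 + ((1 - r) * s) ^+ 2) =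
    (x * ((1 + r) * Y) - y * ((1 - r) * s)) ^+ 2 + (x * ((1 - r) * s) + y * ((1 + r) * Y)) ^+ 2 by ring.
  by rewrite e1 e2; ring.
have Z0 : 0 <= (1 - r) * N / Y by rewrite divr_ge0 ?mulr_ge0 ?(ltW N0) ?(ltW Y0)//; lra.
rewrite -(ler_pXn2r (n := 2)) ?nnegrE ?sqrtr_ge0//.
rewrite sqr_sqrtr ?addr_ge0 ?sqr_ge0// exprMn exprVn ler_pdivlMr ?exprn_gt0//.
rewrite -key ler_wpM2l ?addr_ge0 ?sqr_ge0//.
apply: (@le_trans _ _ (((1 + r) * Y) ^+ 2)); last by rewrite lerDl sqr_ge0.
by rewrite exprMn ler_peMl ?sqr_ge0// expr2; nra.
Qed.

End Circle.

(** * Elementary estimates: triangle inequality, geometric decay, telescoping *)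

Lemma sqmod_triangle (R : realType) (a b : R[i]) :
  Num.sqrt (sqmod (a + b)) <= Num.sqrt (sqmod a) + Num.sqrt (sqmod b).
Proof.
have s0 := sqrtr_ge0 (sqmod a); have t0 := sqrtr_ge0 (sqmod b).
have sa := sqr_sqrtr (sqmod_ge0 a); have sb := sqr_sqrtr (sqmod_ge0 b).
rewrite -(ler_pXn2r (n := 2)) ?nnegrE ?sqrtr_ge0 ?addr_ge0//.
rewrite sqr_sqrtr ?sqmod_ge0// sqrrD sa sb.
set u := Num.sqrt (sqmod a) in sa s0 *; set v := Num.sqrt (sqmod b) in sb t0 *.
have cs : complex.Re a * complex.Re b + complex.Im a * complex.Im b <= u * v.
  apply: le_trans (ler_norm _) _.
  rewrite -(ler_pXn2r (n := 2)) ?nnegrE ?mulr_ge0// real_normK ?num_real//.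
  rewrite exprMn sa sb /sqmod -subr_ge0.
  set d := (X in 0 <= X).
  have -> : d = (complex.Re a * complex.Im b - complex.Im a * complex.Re b) ^+ 2.
    by rewrite /d; ring.
  exact: sqr_ge0.
by rewrite /sqmod cReD cImD; lra.
Qed.

Lemma geometric_small (R : realType) (C x e : R) : 0 <= x < 1 -> 0 < e ->
  exists2 K, (0 < K)%N & C * x ^+ K <= e.
Proof.
move=> /andP[x0 x1] e0.
have c0 : 0 < `|C| + 1 by rewrite ltr_wpDl.
have /cvgrPdist_lt /(_ _ (divr_gt0 e0 c0)) [N _ hN] :
    (GRing.exp x : R^nat) @ \oo --> (0 : R) by apply: cvg_expr; rewrite ger0_norm.
exists N.+1 => //; have /= := hN N.+1 (leqnSn N).
rewrite sub0r normrN ger0_norm ?exprn_ge0// ltr_pdivlMr// => h.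
apply: le_trans (ltW h); rewrite mulrC ler_wpM2l ?exprn_ge0//.
by apply: le_trans (ler_norm _) _; rewrite lerDl.
Qed.

(** The list may skip integers of the window; the increments over the gaps are nonnegative and only
    enlarge the right side. *)
Lemma telescope_le (R : realType) (Q : R -> R) (m : nat) (a : int) (l : seq int) :
  (forall n : int, a <= n < a + m%:Z -> Q n%:~R <= Q (n%:~R + 1)) ->
  uniq l -> (forall n, n \in l -> a <= n < a + m%:Z) ->
  \sum_(n <- l) (Q (n%:~R + 1) - Q n%:~R) <= Q ((a + m%:Z)%:~R) - Q a%:~R.
Proof.
elim: m l => [|m IH] l mono ul hl.
  case: l hl {ul} => [_|n l hl]; first by rewrite big_nil addr0 subrr.
  by have := hl n; rewrite mem_head => /(_ isT); lia.
have mono' n : a <= n < a + m%:Z -> Q n%:~R <= Q (n%:~R + 1).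
  by move=> h; apply: mono; lia.
have e : (a + m.+1%:Z)%:~R = (a + m%:Z)%:~R + 1 :> R.
  by rewrite -[1]/(1%:~R) -intrD; congr (_%:~R); lia.
have [kl|kl] := boolP (a + m%:Z \in l).
  rewrite (perm_big _ (perm_to_rem kl)) big_cons /= e.
  have := IH (rem (a + m%:Z) l) mono' (rem_uniq _ ul).
  suff h n : n \in rem (a + m%:Z) l -> a <= n < a + m%:Z.
    by move/(_ h); lra.
  rewrite mem_rem_uniq// inE => /andP[/eqP ne nl]; have := hl n nl; lia.
have h n : n \in l -> a <= n < a + m%:Z.
  move=> nl; have ne : n != a + m%:Z by apply: contraNneq kl => <-.
  by have := hl n nl; move/eqP: ne; lia.
apply: le_trans (IH l mono' ul h) _.
by rewrite lerD2r e; apply: mono; lia.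
Qed.

(** * The majorant Q *)

Section Majorant.
Variables (R : realType) (H : lmodType R[i]) (ip : H -> H -> R[i]).
Variables (D : set H) (A B : H -> H).
Hypothesis hip : inner_product_axioms ip.
Hypothesis hC : complete_ip ip.
Hypothesis hA : selfadjoint ip D A.
Hypothesis hB : bounded_nonneg ip B.
Variable phi : H.
Notation re := (reform ip).
Notation im := (imform ip).
Notation norm := (ipnorm ip).
Notation beta := (opnorm ip B).
Notation dissip := (dissip A B).
Notation bphi := (re phi (B phi)).
Let hh := ip_hermitian hip.

(** Coercivity gives |w|^2 <= Im <phi, Bw>, which the polynomial approximates within eta. One
    truncation order serves the whole circle because the remainder bound depends only on r. *)
Lemma circle_bound (Y r eta : R) : 0 < Y -> 0 <= r -> r < 1 -> 0 < eta ->
  exists p : {poly R[i]}, complex.Im p.[0] <= bphi / Y /\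
  forall th, exists t w, [/\ t * (1 + polar r th) = Complex 0 (2 * Y) * polar r th,
    D w, dissip (t - Complex 0 Y) w = B phi &
    norm w ^+ 2 <= complex.Im p.[polar r th] + eta].
Proof.
move=> Y0 r0 r1 eta0.
have [|K K0 hK] := @geometric_small R (bphi * (beta * norm (B phi) ^+ 2)) (r ^+ 2) (eta ^+ 2) _
    (exprn_gt0 2 eta0).
  by rewrite sqr_ge0 expr_lt1.
exists (cayley_poly hip hC hA hB Y0 phi K); split.
  by rewrite cayley_poly0//; exact: (resX_im_le hip hC hA hB Y0 phi).
move=> th; set zeta := polar r th.
have mz : sqmod zeta = r ^+ 2 by exact: sqmod_polar.
have z1 : 1 + zeta != 0.
  apply/eqP => /eqP; rewrite addrC addr_eq0 => /eqP z1.
  have : r ^+ 2 < 1 by rewrite expr_lt1.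
  by rewrite -mz z1 sqmodN /sqmod /= expr1n expr0n addr0 ltxx.
pose t := Complex 0 (2 * Y) * zeta / (1 + zeta).
have tz : t * (1 + zeta) = Complex 0 (2 * Y) * zeta by rewrite /t divfK.
have hp : complex.Im (- Complex 0 Y + t) <= 0.
  apply: (cayley_half_plane Y0 _ z1 tz).
  by rewrite mz ltW// expr_lt1.
have [w Dw ew] := dissip_surj hip hC hA hB (B phi) hp.
exists t, w; split=> //; first by rewrite addrC.
have := cayley_remainder hip hC hA hB Y0 tz Dw ew hp K.
rewrite mz => /le_trans /(_ hK).
have := dissip_coercive hip hA hB hp Dw; rewrite ew -(ipnorm_sqr hip).
have -> : - im w (B phi) = imform (fun x y => ip x (B y)) phi w.
  by rewrite (imC hh (B phi) w) opprK /imform (bounded_sym hB).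
set u := imform _ phi w; set v := complex.Im _ => h1 h2.
suff : u - v <= eta by lra.
apply: le_trans (ler_norm _) _.
by rewrite -(ler_pXn2r (n := 2)) ?nnegrE ?(ltW eta0)// real_normK ?num_real.
Qed.

Lemma majorant (S Y delta eta : R) : 0 <= S -> 0 < Y -> 0 < delta -> 0 < eta ->
  exists Q q : R -> R, [/\ (forall t : R, is_derive t 1 Q (q t)),
    (forall t, 0 <= q t),
    (forall (s t : R) v, `|t| <= S -> D v -> dissip (s%:C)%C v = B phi ->
       norm v ^+ 2 / (1 + beta * `|s - t|) ^+ 2 <= q t) &
    Q S - Q (- S) <=
      pi * (1 + beta * delta) ^+ 2 * ((S ^+ 2 + Y ^+ 2) / Y) * (bphi / Y + eta)].
Proof.
move=> S0 Y0 delta0 eta0.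
have b0 := opnorm_ge0 hip hB.
have N0 : 0 < S ^+ 2 + Y ^+ 2 by rewrite ltr_wpDl ?sqr_ge0 ?exprn_gt0.
(* Chosen so that, over [-S, S], the Cayley image of the circle of radius r stays within delta of
   the real axis points; the minimum with 1 keeps r nonnegative. *)
pose r := 1 - Num.min 1 (delta * Y / (S ^+ 2 + Y ^+ 2)).
have r0 : 0 <= r by rewrite subr_ge0 ge_min lexx.
have r1 : r < 1.
  by rewrite ltrBlDr ltrDl lt_min ltr01 divr_gt0 ?mulr_gt0.
have rd : (1 - r) * (S ^+ 2 + Y ^+ 2) <= delta * Y.
  by rewrite /r subKr -ler_pdivlMr// ge_min lexx orbT.
have [p [p0 hp]] := circle_bound Y0 r0 r1 eta0.
have [P [dP eP]] := polar_primitive r p.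
(* [U] dominates a squared norm, so it is nonnegative and its primitive [G] is monotone. *)
pose U th := complex.Im p.[polar r th] + eta.
have U0 th : 0 <= U th.
  by have [t [w [_ _ _]]] := hp th; apply: le_trans; exact: sqr_ge0.
pose G th := P th + eta * th.
have dG (th : R) : is_derive th 1 G (U th).
  have dPt := dP th.
  by apply: is_derive_eq; rewrite /GRing.scale /= /U; ring.
have Gmono (a b : R) : a <= b -> G a <= G b.
  by move=> ab; apply: (derive_ge0_le ab (fun x _ => dG x)) => x _; exact: U0.
(* The angle 2 atan (s / Y) has derivative 2Y / (Y^2 + s^2), at least 2Y / (Y^2 + S^2) on [-S, S];
   [k] compensates for this and for the loss (1 + beta delta)^2 in the comparison. *)
pose k := (1 + beta * delta) ^+ 2 * (S ^+ 2 + Y ^+ 2) / (2 * Y).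
have k0 : 0 <= k.
  by apply: divr_ge0; rewrite mulr_ge0 ?sqr_ge0 ?ltW.
exists (fun s => k * G (2 * atan (s / Y))).
exists (fun s => k * (U (2 * atan (s / Y)) * (2 * Y / (Y ^+ 2 + s ^+ 2)))).
have NN t : 0 < Y ^+ 2 + t ^+ 2 by rewrite ltr_wpDr ?sqr_ge0 ?exprn_gt0.
split.
- move=> t.
  have d1 : is_derive t 1 (fun u => u / Y) (Y^-1).
    by apply: is_derive_eq; rewrite /GRing.scale /=; ring.
  have d2 := is_derive1_comp (f := atan) (g := fun u => u / Y) (is_derive1_atan _) d1.
  have d3 : is_derive t 1 (fun u => 2 * atan (u / Y)) (2 * Y / (Y ^+ 2 + t ^+ 2)).
    apply: (is_derive_eq (is_deriveZ 2 d2)); rewrite /GRing.scale /=.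
    by field; rewrite !gt_eqF// ltr_wpDr ?sqr_ge0.
  have d4 := is_derive1_comp (f := G) (g := fun u => 2 * atan (u / Y)) (dG _) d3.
  exact: (is_deriveZ k d4).
- move=> t; rewrite mulr_ge0// mulr_ge0// divr_ge0 ?(ltW (NN t))//.
  by rewrite mulr_ge0 ?(ltW Y0).
- move=> s t v tS Dv ev.
  have [c [w [hc Dw ew hw]]] := hp (2 * atan (t / Y)).
  have near := cayley_near Y0 r0 r1 hc.
  have d : Num.sqrt (sqmod ((s%:C)%C - (c - Complex 0 Y))) <= `|s - t| + delta.
    have -> : (s%:C)%C - (c - Complex 0 Y) = ((s - t)%:C)%C + - (c - Complex 0 Y - (t%:C)%C).
      by apply: complex_eq; case: c {hc ew near} => ? ? /=; ring.
    apply: le_trans (sqmod_triangle _ _) _; apply: lerD.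
      by rewrite /sqmod /= expr0n addr0 sqrtr_sqr.
    rewrite sqmodN; apply: le_trans near _; rewrite ler_pdivrMr//.
    apply: le_trans rd; rewrite ler_wpM2l ?subr_ge0 ?(ltW r1)//.
    have : t ^+ 2 <= S ^+ 2 by rewrite -real_normK ?num_real// ler_pXn2r ?nnegrE.
    by lra.
  have i0 : complex.Im (s%:C)%C <= 0 by [].
  (* Uses 1 + beta (|s - t| + delta) <= (1 + beta delta) (1 + beta |s - t|). *)
  have cmp : norm v <= (1 + beta * delta) * (1 + beta * `|s - t|) * norm w.
    have := dissip_compare hip hA hB i0 Dv Dw (etrans ev (esym ew)) => h.
    apply: le_trans h _; rewrite ler_wpM2r ?ipnorm_ge0//.
    have := ler_wpM2l b0 d; have := mulr_ge0 b0 (ltW delta0).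
    have := mulr_ge0 b0 (normr_ge0 (s - t)).
    by nra.
  have m0 : 0 < 1 + beta * `|s - t| by rewrite ltr_wpDr// mulr_ge0.
  have l0 : 0 < 1 + beta * delta by rewrite ltr_wpDr// mulr_ge0// ltW.
  rewrite ler_pdivrMr ?exprn_gt0//.
  have U2 : norm v ^+ 2 <= (1 + beta * delta) ^+ 2 * (1 + beta * `|s - t|) ^+ 2 * U (2 * atan (t / Y)).
    apply: (@le_trans _ _ ((1 + beta * delta) ^+ 2 * (1 + beta * `|s - t|) ^+ 2 * norm w ^+ 2)).
      by rewrite -!exprMn ler_pXn2r ?nnegrE ?ipnorm_ge0// !mulr_ge0 ?ipnorm_ge0 ?ltW.
    by rewrite ler_wpM2l// mulr_ge0 ?sqr_ge0.
  apply: le_trans U2 _; rewrite [leLHS]mulrAC ler_wpM2r ?sqr_ge0//.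
  rewrite [leLHS]mulrC [leRHS]mulrCA ler_wpM2l//.
  have -> : k * (2 * Y / (Y ^+ 2 + t ^+ 2)) =
      (1 + beta * delta) ^+ 2 * ((S ^+ 2 + Y ^+ 2) / (Y ^+ 2 + t ^+ 2)).
    by rewrite /k; field; rewrite !gt_eqF.
  rewrite ler_peMr ?sqr_ge0// ler_pdivlMr// mul1r [leRHS]addrC lerD2l.
  by rewrite -real_normK ?num_real// ler_pXn2r ?nnegrE.
- rewrite -mulrBr mulNr atanN mulrN.
  have pi0 := pi_gt0 R.
  (* The angles of -S and S lie in [-pi, pi], so the increase of [G] between them is at most that
     over a full turn, which the mean value property evaluates. *)
  have G1 : G (2 * atan (S / Y)) <= G pi by apply: Gmono; have := atan_ltpi2 (S / Y); lra.
  have G2 : G (- pi) <= G (- (2 * atan (S / Y))) by apply: Gmono; have := atan_ltpi2 (S / Y); lra.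
  have G3 : G pi - G (- pi) <= 2 * pi * (bphi / Y + eta).
    rewrite /G; have := ler_wpM2l (ltW pi0) p0; lra.
  apply: (@le_trans _ _ (k * (2 * pi * (bphi / Y + eta)))).
    by rewrite ler_wpM2l//; lra.
  have -> : k * (2 * pi * (bphi / Y + eta)) =
    pi * (1 + beta * delta) ^+ 2 * ((S ^+ 2 + Y ^+ 2) / Y) * (bphi / Y + eta).
    by rewrite /k; field; rewrite gt_eqF.
  exact: lexx.
Qed.

End Majorant.

(** * From finite sums to the sum over the integers *)

Lemma seq_int_bounded (l : seq int) : exists2 m : nat, (0 < m)%N &
  forall n, n \in l -> - m%:Z <= n < m%:Z.
Proof.
elim: l => [|k l [m m0 hm]]; first by exists 1%N.
exists (maxn m `|k|.+1)%N => [|n]; first by rewrite leq_max m0.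
by rewrite inE => /orP[/eqP ->|/hm]; lia.
Qed.

(** Isolates the limit b of the bound on finite sums as e tends to 0, with an error linear in e. *)
Lemma polynomial_bound (R : realFieldType) (beta b e : R) :
  0 <= beta -> 0 <= b -> 0 <= e <= 1 ->
  (1 + beta * e) ^+ 2 * (1 + e ^+ 2) * (b + e) <=
  b + e * ((1 + beta) ^+ 2 * 2 * (b + 1)).
Proof.
move=> beta0 b0 /andP[e0 e1].
have ee : e ^+ 2 <= e by rewrite expr2 ler_piMr.
have k1 : (1 + beta * e) ^+ 2 <= 1 + e * ((1 + beta) ^+ 2 - 1).
  by have := ler_wpM2l (sqr_ge0 beta) ee; lra.
have k2 : 1 + e ^+ 2 <= 1 + e by rewrite lerD2l.
have k3 : (1 + beta * e) ^+ 2 * (1 + e ^+ 2) <= 1 + e * ((1 + beta) ^+ 2 * 2 - 1).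
  apply: le_trans (ler_pM _ _ k1 k2) _; rewrite ?sqr_ge0 ?addr_ge0 ?sqr_ge0//.
  set c := (1 + beta) ^+ 2 - 1; have c0 : 0 <= c by rewrite /c; nra.
  have -> : (1 + beta) ^+ 2 = c + 1 by rewrite /c; ring.
  by have := ler_wpM2l c0 ee; lra.
apply: le_trans (ler_wpM2r (addr_ge0 b0 e0) k3) _.
set c := (1 + beta) ^+ 2 * 2; have c1 : 1 <= c by rewrite /c; nra.
have : e * (c - 1) * e <= e * (c - 1).
  by rewrite -[leRHS]mulr1 ler_wpM2l// mulr_ge0// subr_ge0.
nra.
Qed.

Unset Implicit Arguments.
Set Strict Implicit.
Set Printing Implicit Defensive.

Theorem theorem3p1 (R : realType) (H : lmodType R[i]) (ip : H -> H -> R[i])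
  (D : set H) (A B : H -> H)
  (hH : separable_hilbert_space ip)
  (hA : selfadjoint ip D A)
  (hB : bounded_nonneg ip B)
  (phi : H) :
  ((\esum_(n in [set: int])
     ereal_sup [set (complex.Re
                  (ip (B phi)
                      (sq1inv D (fun x => A x + ((n%:~R + y)%:C)%C *: B x)
                              (B phi))))%:E
               | y in `[0%R, 1%R]])
  <= (pi * opnorm ip B * (1 + opnorm ip B) * ipnorm ip phi ^+ 2)%:E)%E.
Proof.
have [hip hC _] := hH.
set beta := opnorm ip B; have beta0 : 0 <= beta := opnorm_ge0 hip hB.
have pi0 : 0 < pi :> R := pi_gt0 R.
pose b := reform ip phi (B phi).
have b0 : 0 <= b := bounded_re_ge0 hip hB phi.
have bB : b <= beta * ipnorm ip phi ^+ 2 := bounded_form_le hip hB phi.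
pose F n := ereal_sup [set (complex.Re
                  (ip (B phi)
                      (sq1inv D (fun x => A x + ((n%:~R + y)%:C)%C *: B x)
                              (B phi))))%:E
               | y in `[0%R, 1%R]].
have finite_bound (l : seq int) (e : R) : uniq l -> 0 < e -> e <= 1 ->
    ((\sum_(n <- l) F n)%E <=
     ((1 + beta) * pi * ((1 + beta * e) ^+ 2 * (1 + e ^+ 2) * (b + e)))%:E)%E.
  move=> ul e0 e1; have [m m0 hm] := seq_int_bounded l.
  (* The intervals [n, n + 1] for n in [l] lie in [-S, S]. Taking Y = S / e, delta = e and eta = e /
     Y makes the bound of [majorant] free of S. *)
  pose S : R := m%:R; have S0 : 0 < S by rewrite ltr0n.
  pose Y := S / e; have Y0 : 0 < Y by rewrite divr_gt0.
  have [Q [q [dQ q0 hq QS]]] :=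
    majorant hip hC hA hB phi (ltW S0) Y0 e0 (divr_gt0 e0 Y0).
  have rng n : n \in l -> - S <= n%:~R /\ n%:~R + 1 <= S.
    move=> /hm /andP[n1 n2]; split.
      by rewrite -[- S]/(- (m%:Z%:~R)) -mulrNz ler_int.
    by rewrite -[1]/(1%:~R) -intrD -[S]/(m%:Z%:~R) ler_int; lia.
  have term n : n \in l -> (F n <= ((1 + beta) * (Q (n%:~R + 1) - Q n%:~R))%:E)%E.
    move=> nl; have [n1 n2] := rng n nl.
    apply: ub_ereal_sup => _ [y + <-]; rewrite /= in_itv /= => /andP[y0 y1].
    set s := n%:~R + y; have i0 : complex.Im (s%:C)%C <= 0 by [].
    have [v Dv ev] := dissip_surj hip hC hA hB (B phi) i0.
    rewrite lee_fin; apply: le_trans (sq1inv_le hip hA hB Dv ev) _.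
    apply: (@harnack_interval R Q q beta _ n%:~R s) => //.
    - exact: sqr_ge0.
    - by rewrite /s lerDl y0 lerD2l.
    - move=> t; rewrite in_itv /= => /andP[t1 t2]; apply: (hq s t v) => //.
      by rewrite ler_norml; lra.
  apply: (@le_trans _ _ (\sum_(n <- l) ((1 + beta) * (Q (n%:~R + 1) - Q n%:~R))%:E)%E).
    by rewrite big_seq [leRHS]big_seq; apply: lee_sum.
  rewrite sumEFin lee_fin -mulr_sumr -[leRHS]mulrA ler_wpM2l ?addr_ge0//.
  (* The window consists of the 2m integers from -m to m - 1, so the telescoped endpoints are -S and
     S. *)
  have tel : \sum_(n <- l) (Q (n%:~R + 1) - Q n%:~R) <=
      Q ((- m%:Z + (m + m)%:Z)%:~R) - Q (- m%:Z)%:~R.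
    apply: telescope_le => //.
      move=> n _; apply: (derive_ge0_le _ (fun x _ => dQ x)) => [|x _]; last exact: q0.
      by rewrite lerDl.
    by move=> n /hm; lia.
  apply: le_trans tel _.
  have -> : (- m%:Z + (m + m)%:Z)%:~R = S :> R.
    by rewrite -[S]/(m%:Z%:~R); congr (_%:~R); lia.
  rewrite mulrNz; apply: le_trans QS _.
  rewrite le_eqVlt; apply/orP; left; apply/eqP.
  by rewrite /Y -/beta -/b; field; rewrite !gt_eqF.
(* The sum is the supremum of its finite subsums. [Q] depends on the finite set but the bound does
   not, so [e] can be chosen from [eps] alone. *)
apply: ub_ereal_sup => _ [X [finX _] <-].
rewrite fsbig_finite//=; set l := fset_set X.
apply/lee_addgt0Pr => eps eps0.
(* The coefficient of e in [polynomial_bound], multiplied by (1 + beta) pi. *)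
pose C := (1 + beta) * pi * ((1 + beta) ^+ 2 * 2 * (b + 1)).
have C0 : 0 < C by rewrite /C !mulr_gt0 ?exprn_gt0//; lra.
pose e := Num.min 1 (eps / C).
have e0 : 0 < e by rewrite lt_min ltr01 divr_gt0.
have e1 : e <= 1 by rewrite ge_min lexx.
have eC : e * C <= eps by rewrite -ler_pdivlMr// ge_min lexx orbT.
apply: le_trans (finite_bound l e (fset_uniq _) e0 e1) _.
rewrite -EFinD lee_fin.
have c0 : 0 <= (1 + beta) * pi by apply: mulr_ge0; [rewrite addr_ge0|exact: ltW].
have e01 : 0 <= e <= 1 by rewrite (ltW e0).
have h := polynomial_bound beta0 b0 e01.
have := ler_wpM2l c0 h; have := ler_wpM2l c0 bB; rewrite /C in eC; lra.
Qed.
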